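(* Let $r,s\ge 3$ be integers such that either $r\equiv 1\pmod 4$ and $s\equiv 0\pmod 4$, or $r\equiv 3\pmod 4$ and $s\equiv 2\pmod 4$. Then $$ac(T_{r,s})=\frac{1}{8}\left(r^2s+rs^2-rs-2r-2s+2\right).$$
   Context: $T_{r,s}=C_r\square C_s$ is the toroidal grid, the Cartesian product of the cycles on $r$ and $s$ vertices ($r,s\ge3$): vertices are pairs $(i,j)$ with $0\le i\le r-1$, $0\le j\le s-1$, and two vertices are adjacent iff they agree in one coordinate and the other coordinates are adjacent in the corresponding cycle. For a connected graph $G$ with diameter $d\ge 2$ and graph distance $d(u,v)$, an antipodal coloring is a map $g$ from $V(G)$ to the non-negative integers with $|g(u)-g(v)|\ge d-d(u,v)$ for all distinct vertices $u,v$. The span of $g$ is the largest integer assigned by $g$, and the antipodal number $ac(G)$ is the minimum span among all antipodal colorings of $G$. *)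

(* Defs.v *)
From mathcomp Require Import all_boot all_order all_algebra.
From mathcomp Require Import boolp.

Set Implicit Arguments.
Unset Strict Implicit.
Unset Printing Implicit Defensive.

Section AntipodalColoring.

(* A finite simple graph is a symmetric irreflexive relation [e]. *)
Variables (T : finType) (e : rel T).

Definition walk_of_length (u v : T) (n : nat) : bool :=
  [exists p : n.-tuple T, path e u p && (last u p == v)].

(* A shortest walk visits no vertex twice, so it has length below [#|T|];
   by convention the distance is [#|T|] when [v] is unreachable from [u]. *)
Definition dist (u v : T) : nat := find (walk_of_length u v) (iota 0 #|T|).

Definition diameter : nat := \max_(u : T) \max_(v : T) dist u v.

(* The truncated subtraction on the left never truncates:
   [dist u v <= diameter] always holds. *)
Definition antipodal_coloring (g : T -> nat) : Prop :=
  forall u v : T, u != v -> diameter - dist u v <= `|g u - g v|.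

Definition span (g : T -> nat) : nat := \max_(v : T) g v.

Definition is_antipodal_span (n : nat) : Prop :=
  exists g : T -> nat, antipodal_coloring g /\ span g = n.

Lemma antipodal_span_exists : exists n, `[< is_antipodal_span n >].
Proof.
pose g (v : T) := enum_rank v * diameter.
exists (span g); apply/asboolP; exists g; split=> // u v neq_uv.
apply: leq_trans (leq_subr _ _) _; rewrite /g.
wlog lt_uv: u v neq_uv / enum_rank u < enum_rank v.
  move=> IH; have : enum_rank u != enum_rank v by rewrite (inj_eq enum_rank_inj).
  rewrite -val_eqE neq_ltn => /orP[/IH|/IH]; first exact.
  by rewrite distnC; apply; rewrite eq_sym.
by rewrite distnC distnEl ?leq_mul2r ?(ltnW lt_uv) ?orbT // -mulnBl leq_pmull ?subn_gt0.
Qed.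

Definition antipodal_number : nat := ex_minn antipodal_span_exists.

End AntipodalColoring.

Definition cycle_graph (n : nat) : rel 'I_n :=
  fun i j => (i.+1 == j %[mod n]) || (j.+1 == i %[mod n]).

Definition cartesian_product (T1 T2 : finType) (e1 : rel T1) (e2 : rel T2) :
    rel (T1 * T2) :=
  fun x y => ((x.1 == y.1) && e2 x.2 y.2) || ((x.2 == y.2) && e1 x.1 y.1).

Definition toroidal_grid (r s : nat) : rel ('I_r * 'I_s) :=
  cartesian_product (@cycle_graph r) (@cycle_graph s).

(* Main.v *)
Require Import Defs.
From mathcomp Require Import all_boot all_order all_algebra.
From mathcomp Require Import zify ring.

Set Implicit Arguments.
Unset Strict Implicit.
Unset Printing Implicit Defensive.

(** Write r = 2m+1 and s = 2h.  For r odd and s even, the two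
    congruence cases say exactly that m + h is even.  With m + h = 2k the
    diameter is 2k, and the claimed value is k (rh - 1).

    Lower bound.  Three points of a cycle of length n have pairwise distances
    adding up to at most n, so three vertices of the torus have pairwise
    distances adding up to at most r + s = 4k + 1.  Adding the three colouring
    conditions for vertices coloured a <= b <= c gives
    2 (c - a) >= 6k - (4k + 1), that is, c - a >= k.  Hence a window of k
    consecutive colours contains at most two vertices, and the 2rh vertices
    need at least rh windows; as the count of full windows below colour
    k (rh - 1) is rh - 1, some colour is at least k (rh - 1)
    ([card_le_two_per_window], [antipodal_span_ge]).

    Upper bound.  For equality the vertices must come in antipodal pairs that
    receive the colours 0, k, 2k, ...  Take the pairs
    {(x, y), (x + m, y + h)} with 0 <= y < h.  Such a pair consists of
    vertices at distance 2k, so any vertex at distance exactly k from one of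
    them is at distance at least k from the other.  It therefore suffices to
    visit all the base points (x, y) of Z_r x [0, h) once each, by steps of
    length exactly k in the metric cdist + |y - y'| ([coloring_of_tour]).  Such
    a tour is explicit:
    - if r = 4a+1, h = 2b and k = a + b, alternate between the rows y and
      y + b while moving by a in the cycle; since a is prime to r and r is
      odd, this sweeps both rows in 2r vertices, after which a step
      (a + 1, b - 1) leads to the next pair of rows ([block_tour_coloring]);
    - if r = 4a+3, h = 2b+1 and k = a + b + 1, the odd number of rows cannot
      be paired; instead run through all h rows cyclically, by row changes of
      b + 1 and b, the horizontal moves being a and a + 1 with signs
      chosen so that the total drift of one turn is prime to r; then r turns
      visit everything ([helical_tour_coloring]). *)

(** * Recognising the distance of a graph *)

(** Local conditions that characterise the graph distance: the step condition
    bounds [d] above by the length of any walk, and following the descents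
    produces a walk of length [d u v]. *)
Record graph_metric (T : Type) (e : rel T) (d : T -> T -> nat) : Prop :=
  GraphMetric {
    metric_refl : forall u, d u u = 0;
    metric_step : forall u w v, e u w -> d u v <= (d w v).+1;
    metric_descent : forall u v, u <> v -> exists2 w, e u w & d u v = (d w v).+1
  }.

Lemma metric_le_path (T : Type) (e : rel T) (d : T -> T -> nat) (u : T) p :
  graph_metric e d -> path e u p -> d u (last u p) <= size p.
Proof.
case=> drefl dstep _; elim: p u => [|w p IHp] u /=; first by rewrite drefl.
by case/andP=> /(dstep _ _ (last w p)) le_uw /IHp le_w; exact: leq_trans le_uw _.
Qed.

Lemma metric_walk (T : finType) (e : rel T) (d : T -> T -> nat) (u v : T) :
  graph_metric e d -> walk_of_length e u v (d u v).
Proof.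
case=> drefl _ desc; move def_n: (d u v) => n.
elim: n u def_n => [|n IHn] u def_n.
  apply/existsP; exists [tuple]; rewrite /=.
  by case: eqVneq => // /eqP/desc[w _]; rewrite def_n.
have /desc[w euw] : u <> v by move=> euv; rewrite euv drefl in def_n.
rewrite def_n => -[/esym/IHn/existsP[p /andP[pth /eqP lst]]].
by apply/existsP; exists [tuple of w :: p]; rewrite /= euw pth lst eqxx.
Qed.

(** [dist] returns [#|T|] when its search fails, so a bound on [d] is what
    ensures that the walks of length [d u v] are found. *)
Lemma dist_metric (T : finType) (e : rel T) (d : T -> T -> nat) :
  graph_metric e d -> (forall u v, d u v < #|T|) -> dist e =2 d.
Proof.
move=> dm ltdT u v; have wd := metric_walk u v dm.
have hasw : has (walk_of_length e u v) (iota 0 #|T|).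
  by apply/hasP; exists (d u v); rewrite // mem_iota /=.
apply/eqP; rewrite eqn_leq; apply/andP; split.
  rewrite leqNgt; apply/negP => /(before_find 0).
  by rewrite nth_iota // add0n wd.
have := nth_find 0 hasw; move: hasw; rewrite has_find size_iota => lt_find.
rewrite nth_iota // add0n.
case/existsP=> p /andP[/(metric_le_path dm) + /eqP lst].
by rewrite lst size_tuple.
Qed.

(** A shortest path in a product moves the coordinates independently, so
    distances add up. *)
Lemma metric_product (T1 T2 : finType) (e1 : rel T1) (e2 : rel T2) d1 d2 :
  graph_metric e1 d1 -> graph_metric e2 d2 ->
  graph_metric (cartesian_product e1 e2)
    (fun x y => d1 x.1 y.1 + d2 x.2 y.2).
Proof.
move=> [refl1 step1 desc1] [refl2 step2 desc2]; split.
- by move=> u; rewrite refl1 refl2.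
- move=> u w v /orP[]/andP[/eqP->].
    by move=> /(step2 _ _ v.2); rewrite -addnS leq_add2l.
  by move=> /(step1 _ _ v.1); rewrite -addSn leq_add2r.
- move=> [u1 u2] [v1 v2] /= neq_uv.
  have [eq1 | /eqP/desc1[w euw dw]] := eqVneq u1 v1.
    have /desc2[w euw dw] : u2 <> v2 by move=> eq2; rewrite eq1 eq2 in neq_uv.
    by exists (u1, w); rewrite /= ?dw ?addnS // /cartesian_product /= eqxx euw.
  by exists (w, u2); rewrite /= ?dw // /cartesian_product /= eqxx euw orbT.
Qed.

(** * Distances in cycles and in the torus *)

(** The length of the shorter arc between [i] and [j]; with truncated
    subtraction, [(i - j) + (j - i)] is the absolute difference. *)
Definition cdist (n i j : nat) : nat :=
  minn ((i - j) + (j - i)) (n - ((i - j) + (j - i))).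

Lemma cdist_perimeter n i j l : i < n -> j < n -> l < n ->
  cdist n i j + cdist n j l + cdist n l i <= n.
Proof. by rewrite /cdist; lia. Qed.

Lemma cdistC n i j : cdist n i j = cdist n j i.
Proof. by rewrite /cdist; lia. Qed.

Lemma modnS_eq n i j : i < n -> j < n ->
  (i.+1 == j %[mod n]) = (i.+1 == j) || (i.+1 == n) && (j == 0).
Proof.
move=> lt_i lt_j; rewrite (modn_small lt_j).
have [-> | ne_n] := eqVneq i.+1 n; first by rewrite modnn; lia.
by rewrite modn_small; lia.
Qed.

Lemma metric_cycle n :
  graph_metric (@cycle_graph n) (fun i j => cdist n i j).
Proof.
(* The descent walks along the shorter arc from [i] to [j], which may cross
   the boundary between [n.-1] and [0]. *)
split=> [i | i w j | i j].
- by rewrite /cdist; lia.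
- have [[lt_i lt_w] lt_j] := (ltn_ord i, ltn_ord w, ltn_ord j).
  by rewrite /cycle_graph !modnS_eq // /cdist; lia.
- have [lt_i lt_j] := (ltn_ord i, ltn_ord j); move=> /eqP.
  rewrite -val_eqE /= => neq_ij.
  have [w [lt_w iw dw]] : exists w : nat, [/\ w < n,
      (i.+1 == w) || (i.+1 == n) && (w == 0)
      || ((w.+1 == i) || (w.+1 == n) && (i == 0 :> nat))
      & cdist n i j = (cdist n w j).+1].
    rewrite /cdist; have [lt_ij | le_ji] := ltnP i j.
      have [far | near] := ltnP n (j - i).*2; last by exists i.+1; split; lia.
      have [i0 | i_gt0] := posnP i; last by exists i.-1; split; lia.
      by exists n.-1; split; lia.
    have [far | near] := ltnP n (i - j).*2; last by exists i.-1; split; lia.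
    have [lt_in | ] := ltnP i.+1 n; first by exists i.+1; split; lia.
    by exists 0; split; lia.
  by exists (Ordinal lt_w); rewrite // /cycle_graph /= !modnS_eq.
Qed.

Definition torus_dist (r s : nat) (u v : 'I_r * 'I_s) : nat :=
  cdist r u.1 v.1 + cdist s u.2 v.2.

Lemma torus_perimeter r s (u v w : 'I_r * 'I_s) :
  torus_dist u v + torus_dist v w + torus_dist w u <= r + s.
Proof.
have := leq_add (cdist_perimeter (ltn_ord u.1) (ltn_ord v.1) (ltn_ord w.1))
  (cdist_perimeter (ltn_ord u.2) (ltn_ord v.2) (ltn_ord w.2)).
by rewrite /torus_dist; lia.
Qed.

Lemma dist_torus m h (u v : 'I_m.*2.+1 * 'I_h.*2) :
  dist (@toroidal_grid m.*2.+1 h.*2) u v = torus_dist u v.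
Proof.
apply: (dist_metric (metric_product (@metric_cycle _) (@metric_cycle _))).
move=> x y; rewrite card_prod !card_ord.
have [??] := (ltn_ord x.2, ltn_ord y.2).
have : m.+1 * h.+1 <= m.*2.+1 * h.*2 by apply: leq_mul; lia.
rewrite mulSn mulnS /cdist; lia.
Qed.

Lemma diameter_torus m h : 0 < h ->
  diameter (@toroidal_grid m.*2.+1 h.*2) = m + h.
Proof.
move=> h_gt0; apply/eqP; rewrite eqn_leq; apply/andP; split.
  apply/bigmax_leqP=> u _; apply/bigmax_leqP=> v _.
  rewrite dist_torus /torus_dist /cdist.
  have [??] := (ltn_ord u.2, ltn_ord v.2); lia.
have [lt0r ltmr] : 0 < m.*2.+1 /\ m < m.*2.+1 by lia.
have [lt0s lths] : 0 < h.*2 /\ h < h.*2 by lia.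
pose u := (Ordinal lt0r, Ordinal lt0s); pose v := (Ordinal ltmr, Ordinal lths).
apply: leq_trans (leq_bigmax_cond _ (isT : xpredT u)).
apply: leq_trans (leq_bigmax_cond _ (isT : xpredT v)).
by rewrite dist_torus /torus_dist /cdist /=; lia.
Qed.

(** * The lower bound *)

(** Cut the colours into [N] windows of length [k]: three vertices in one
    window would violate the spread condition. *)
Lemma card_le_two_per_window (T : finType) (g : T -> nat) (k N : nat) :
  (forall v, g v < k * N) ->
  (forall u v w, u != v -> v != w -> w != u ->
     g u <= g v -> g v <= g w -> g u + k <= g w) ->
  #|T| <= 2 * N.
Proof.
move=> ltg spread.
have [k0 | k_gt0] := posnP k.
  by rewrite (eq_card0 (A := T)) // => v; have := ltg v; rewrite k0.
have ltgk v : g v %/ k < N by rewrite ltn_divLR // mulnC.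
pose c v : 'I_N := Ordinal (ltgk v).
have -> : #|T| = \sum_(i < N) #|[pred v | c v == i]|.
  rewrite -sum1_card (partition_big c predT) //=.
  by apply: eq_bigr => i _; rewrite sum1_card.
have -> : 2 * N = \sum_(i < N) 2 by rewrite sum_nat_const card_ord mulnC.
apply: leq_sum => i _; rewrite leqNgt; apply/negP => /card_gt2P[x [y [z]]].
rewrite !inE => -[[/eqP cx /eqP cy /eqP cz] [nxy nyz nzx]].
have win v : c v = i -> i * k <= g v < i * k + k.
  by move=> <- /=; rewrite leq_trunc_div /= -mulSnr ltn_ceil.
have [/win Hx /win Hy /win Hz] := And3 cx cy cz.
have [nyx nzy nxz] : [/\ y != x, z != y & x != z].
  by split; rewrite eq_sym.
have := spread x y z nxy nyz nzx; have := spread x z y nxz nzy nyx.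
have := spread y x z nyx nxz nzy; have := spread y z x nyz nzx nxy.
have := spread z x y nzx nxy nyz; have := spread z y x nzy nyx nxz.
lia.
Qed.

Lemma antipodal_span_ge m h k (g : 'I_m.*2.+1 * 'I_h.*2 -> nat) :
  0 < h -> m + h = k.*2 -> antipodal_coloring (@toroidal_grid _ _) g ->
  k * (m.*2.+1 * h).-1 <= Defs.span g.
Proof.
move=> h_gt0 def_k gP; rewrite leqNgt; apply/negP => lt_span.
suff : #|{: 'I_m.*2.+1 * 'I_h.*2}| <= 2 * (m.*2.+1 * h).-1.
  rewrite card_prod !card_ord -(muln2 h) mulnA.
  have : 0 < m.*2.+1 * h by rewrite muln_gt0 h_gt0.
  lia.
apply: (@card_le_two_per_window _ g k).
  by move=> v; apply: leq_ltn_trans lt_span; apply: leq_bigmax.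
move=> u v w nuv nvw nwu le_uv le_vw.
have := gP _ _ nuv; have := gP _ _ nvw; have := gP _ _ nwu.
rewrite !dist_torus diameter_torus //; have := torus_perimeter u v w.
rewrite (distnC (g w)) !distnEr ?(leq_trans le_uv) //; lia.
Qed.

(** * Colouring antipodal pairs along a tour *)

(** Translation by [-m] in the cycle of length [2m+1]; it sends the first
    coordinate of the upper vertex [(x + m, y + h)] of a pair back to [x]. *)
Definition half_turn (m i : nat) : nat := if i < m then i + m.+1 else i - m.

Lemma half_turn_inj m i i' : i < m.*2.+1 -> i' < m.*2.+1 ->
  half_turn m i = half_turn m i' -> i = i'.
Proof. by rewrite /half_turn; case: (ltnP i m); case: (ltnP i' m); lia. Qed.

Lemma cdist_half_turn m i : i < m.*2.+1 ->
  cdist m.*2.+1 (half_turn m i) i = m.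
Proof. by rewrite /half_turn /cdist; case: (ltnP i m); lia. Qed.

Lemma cdist_half_turn2 m i i' : i < m.*2.+1 -> i' < m.*2.+1 ->
  cdist m.*2.+1 (half_turn m i) (half_turn m i') = cdist m.*2.+1 i i'.
Proof.
by rewrite /half_turn /cdist; case: (ltnP i m); case: (ltnP i' m); lia.
Qed.

(** The triangle inequality, as [half_turn m i] is at distance [m]
    from [i]. *)
Lemma cdist_half_turn_ge m x i : x < m.*2.+1 -> i < m.*2.+1 ->
  m <= cdist m.*2.+1 x (half_turn m i) + cdist m.*2.+1 x i.
Proof. by rewrite /half_turn /cdist; case: (ltnP i m); lia. Qed.

(** The vertices with the same base form an antipodal pair, and every vertex
    lies in exactly one pair. *)
Definition pair_base (m h : nat) (u : 'I_m.*2.+1 * 'I_h.*2) : nat * nat :=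
  if u.2 < h then (val u.1, val u.2) else (half_turn m u.1, u.2 - h).

Lemma pair_base_lt m h (u : 'I_m.*2.+1 * 'I_h.*2) :
  (pair_base u).1 < m.*2.+1 /\ (pair_base u).2 < h.
Proof.
case: u => [[i lt_i] [j lt_j]]; rewrite /pair_base /half_turn /=.
by case: (ltnP i m) => ?; case: (ltnP j h) => ? /=; split; lia.
Qed.

Lemma dist_same_base m h (u v : 'I_m.*2.+1 * 'I_h.*2) :
  u != v -> pair_base u = pair_base v -> torus_dist u v = m + h.
Proof.
case: u v => [[i lt_i] [j lt_j]] [[i' lt_i'] [j' lt_j']].
rewrite xpair_eqE -!val_eqE /torus_dist /pair_base /=.
case: (ltnP j h) => le_j; case: (ltnP j' h) => le_j' neq [eq1 eq2].
- by rewrite eq1 eq2 !eqxx in neq.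
- by rewrite eq1 eq2 cdist_half_turn // /cdist; lia.
- by rewrite -eq1 -eq2 cdistC cdist_half_turn // /cdist; lia.
- by move: neq; rewrite (half_turn_inj lt_i lt_i' eq1) eqxx; lia.
Qed.

(** If [u] and [v] are on the same side of their pairs, their distance is that
    of the bases, namely [k]; otherwise [v] is antipodal to a vertex at
    distance [k] from [u], hence at distance at least [2k - k] from [u].  This
    is why the bases must be at distance exactly [k]. *)
Lemma dist_next_base m h k (u v : 'I_m.*2.+1 * 'I_h.*2) :
  m + h = k.*2 ->
  cdist m.*2.+1 (pair_base u).1 (pair_base v).1
    + (((pair_base u).2 - (pair_base v).2) + ((pair_base v).2 - (pair_base u).2))
    = k ->
  k <= torus_dist u v.
Proof.
case: u v => [[i lt_i] [j lt_j]] [[i' lt_i'] [j' lt_j']] def_k.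
rewrite /torus_dist /pair_base /=.
case: (ltnP j h) => le_j; case: (ltnP j' h) => le_j' /=.
- by rewrite [cdist h.*2 _ _]/cdist; lia.
- have := cdist_half_turn_ge lt_i lt_i'.
  by rewrite [cdist h.*2 _ _]/cdist; lia.
- have := cdist_half_turn_ge lt_i' lt_i; rewrite !(cdistC _ i').
  by rewrite [cdist h.*2 _ _]/cdist; lia.
- by rewrite cdist_half_turn2 // [cdist h.*2 _ _]/cdist; lia.
Qed.

(** The two vertices of the pair visited at time [t] get colour [k t].  Visits
    two or more apart are separated by [2k], the diameter, so only simultaneous
    and consecutive visits matter. *)
Lemma coloring_of_tour m h k (x y : nat -> nat) :
  m + h = k.*2 ->
  (forall t, t < m.*2.+1 * h -> x t < m.*2.+1 /\ y t < h) ->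
  (forall t t', t < m.*2.+1 * h -> t' < m.*2.+1 * h ->
     x t = x t' -> y t = y t' -> t = t') ->
  (forall t, t.+1 < m.*2.+1 * h ->
     cdist m.*2.+1 (x t) (x t.+1) + ((y t - y t.+1) + (y t.+1 - y t)) = k) ->
  exists g : 'I_m.*2.+1 * 'I_h.*2 -> nat,
    antipodal_coloring (@toroidal_grid _ _) g
    /\ Defs.span g <= k * (m.*2.+1 * h).-1.
Proof.
move=> def_k bound inj step; set N := m.*2.+1 * h in bound inj step *.
(* An injective sequence of full length visits every base, so that the time
   of a visit is a function of the vertex. *)
pose f (t : 'I_N) : 'I_m.*2.+1 * 'I_h :=
  (Ordinal (proj1 (bound t (ltn_ord t))), Ordinal (proj2 (bound t (ltn_ord t)))).
have inj_f : injective f.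
  by move=> t t' [? ?]; apply: val_inj; apply: inj (ltn_ord t) (ltn_ord t') _ _.
have [f' _ f'K] : bijective f.
  by apply: inj_card_bij; rewrite // card_prod !card_ord.
pose b (u : 'I_m.*2.+1 * 'I_h.*2) : 'I_m.*2.+1 * 'I_h :=
  (Ordinal (proj1 (pair_base_lt u)), Ordinal (proj2 (pair_base_lt u))).
pose time u : nat := f' (b u).
have baseE u : pair_base u = (x (time u), y (time u)).
  rewrite [LHS]surjective_pairing.
  by have [/= -> ->] := congr1 (fun z => (val z.1, val z.2)) (f'K (b u)).
exists (fun u => k * time u); split=> [u v neq_uv | ]; last first.
  apply/bigmax_leqP=> u _; rewrite leq_mul2l /time.
  by case: (f' (b u)) => t /= lt_tN; apply/orP; right; lia.
have h_gt0 : 0 < h by have := ltn_ord u.2; lia.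
rewrite diameter_torus // dist_torus def_k.
wlog le_t : u v neq_uv / time u <= time v.
  move=> IH; case: (leqP (time u) (time v)) => [|/ltnW] /IH; first exact.
  rewrite distnC eq_sym /torus_dist => /(_ neq_uv).
  by rewrite (cdistC _ v.1) (cdistC _ v.2).
rewrite distnEr ?leq_mul2l ?le_t ?orbT // -mulnBr.
move: le_t; rewrite leq_eqVlt => /orP[/eqP eq_t | ].
  by rewrite (dist_same_base neq_uv) ?def_k ?subnn // !baseE eq_t.
rewrite leq_eqVlt => /orP[/eqP eq_t | lt_t].
  have lt_tN : (time u).+1 < N by rewrite eq_t ltn_ord.
  have := @dist_next_base m h k u v def_k.
  rewrite !baseE -eq_t subSnn muln1 => /(_ (step _ lt_tN)); lia.
have : k * 2 <= k * (time v - time u) by rewrite leq_mul2l; lia.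
by rewrite muln2; apply: leq_trans; apply: leq_subr.
Qed.

Lemma antipodal_number_eq (T : finType) (e : rel T) (n : nat) :
  (forall g, antipodal_coloring e g -> n <= Defs.span g) ->
  (exists g, antipodal_coloring e g /\ Defs.span g <= n) ->
  antipodal_number e = n.
Proof.
move=> lower [g [gP le_gn]]; rewrite /antipodal_number.
case: ex_minnP => a /boolp.asboolP[g' [g'P <-]] least.
apply/eqP; rewrite eqn_leq lower // andbT; apply: leq_trans le_gn.
by apply/least/boolp.asboolP; exists g.
Qed.

(** * Modular arithmetic for the tours *)

Lemma cdist_modD n a c : 0 < n -> c <= n ->
  cdist n (a %% n) ((a + c) %% n) = minn c (n - c).
Proof.
move=> n_gt0 le_cn; rewrite -modnDml; have := ltn_pmod a n_gt0.
move: (a %% n) => b lt_bn.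
have [lt_n | le_n] := ltnP (b + c) n.
  by rewrite modn_small // /cdist; lia.
have [-> | ne_cn] := eqVneq c n.
  by rewrite modnDr modn_small // /cdist; lia.
have -> : (b + c) %% n = b + c - n.
  by rewrite -{1}(subnK le_n) modnDr modn_small //; lia.
by rewrite /cdist; lia.
Qed.

Lemma divmodS n t : 0 < n ->
  [/\ t.+1 %/ n = t %/ n, t.+1 %% n = (t %% n).+1 & (t %% n).+1 < n]
  \/ [/\ t.+1 %/ n = (t %/ n).+1, t.+1 %% n = 0 & (t %% n).+1 = n].
Proof.
move=> n_gt0; have tE : t.+1 = t %/ n * n + (t %% n).+1.
  by rewrite addnS -divn_eq.
have := ltn_pmod t n_gt0; rewrite leq_eqVlt => /orP[/eqP eq_n | lt_n].
  by right; rewrite tE eq_n -mulSnr modnMl mulnK.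
left; rewrite {1 2}tE modnMDl divnMDl //.
by rewrite (modn_small lt_n) (divn_small lt_n) addn0.
Qed.

Lemma eqn_modMr_coprime r c x x' : coprime r c ->
  (x * c == x' * c %[mod r]) = (x == x' %[mod r]).
Proof.
move=> co_rc; wlog le_x : x x' / x' <= x.
  by move=> IH; case: (leqP x' x) => [|/ltnW] /IH; rewrite // eq_sym => ->.
by rewrite !eqn_mod_dvd ?leq_mul2r ?le_x ?orbT // -mulnBl Gauss_dvdl.
Qed.

Lemma cdist_mod n a b c : 0 < n -> c <= n -> b = a + c \/ a = b + c ->
  cdist n (a %% n) (b %% n) = minn c (n - c).
Proof. by move=> ? ? []->; [| rewrite cdistC]; rewrite cdist_modD. Qed.

(** * The two tours *)

(** At time [t], [q t] is the number of the current pair of rows, namely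
    [q t] and [q t + b], and [rho t] counts the steps already made in it.  The
    starting abscissa [q t] of a block makes the step between blocks
    one longer than the inner steps, which compensates for the row change
    [b - 1]: after [2r - 1] inner moves the tour is at abscissa [q - a]
    modulo [r], and it goes on from [q + 1]. *)
Lemma block_tour_coloring a b : 0 < a -> 0 < b ->
  exists g : 'I_(a.*2).*2.+1 * 'I_(b.*2).*2 -> nat,
    antipodal_coloring (@toroidal_grid _ _) g
    /\ Defs.span g <= (a + b) * ((a.*2).*2.+1 * b.*2).-1.
Proof.
move=> a_gt0 b_gt0; set r := (a.*2).*2.+1.
have r_gt0 : 0 < r by [].
pose q t := t %/ r.*2; pose rho t := t %% r.*2.
have lt_rho t : rho t < r.*2 by rewrite ltn_pmod // double_gt0.
have lt_q t : t < r * b.*2 -> q t < b.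
  by move=> lt_t; rewrite ltn_divLR ?double_gt0 //; lia.
have tE t : t = q t * r.*2 + rho t by apply: divn_eq.
pose y t := q t + b * odd (rho t).
have y_inj t t' : t < r * b.*2 -> t' < r * b.*2 ->
    y t = y t' -> q t = q t' /\ odd (rho t) = odd (rho t').
  move=> /lt_q + /lt_q; rewrite /y.
  by case: (odd _) (odd _) => [] [] /=; lia.
apply: (@coloring_of_tour _ _ _ (fun t => (q t + rho t * a) %% r) y).
- by rewrite doubleD.
- move=> t /lt_q ltq; rewrite ltn_pmod //; split=> //.
  by rewrite /y; case: (odd _); lia.
- move=> t t' lt_t lt_t' eqx /y_inj[] // eq_q eq_odd.
  suff eq_rho : rho t = rho t' by rewrite (tE t) (tE t') eq_q eq_rho.
  have eq_modr : rho t = rho t' %[mod r].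
    apply/eqP; rewrite -(@eqn_modMr_coprime _ a); last first.
      (* r - 4 a = 1 *)
      by apply/coprimeP=> //; exists (1, 4); rewrite /r /=; lia.
    by move/eqP: eqx; rewrite eq_q eqn_modDl.
  move: eq_modr eq_odd (lt_rho t) (lt_rho t').
  (* Both times are below [2r] and [r] is odd, so the residue modulo [r] and
     the parity determine [rho]. *)
  have small z : z < r.*2 -> z %% r = if z < r then z else z - r.
    case: (ltnP z r) => [/modn_small // | le_rz] lt_z.
    by rewrite -{1}(subnK le_rz) modnDr modn_small //; lia.
  move=> + + lt1 lt2; rewrite !small // /r.
  case: (ltnP (rho t) _) => ?; case: (ltnP (rho t') _) => ?;
    by move: lt1 lt2; rewrite /r; lia.
- move=> t lt_t.
  have : [/\ q t.+1 = q t, rho t.+1 = (rho t).+1 & (rho t).+1 < r.*2]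
      \/ [/\ q t.+1 = (q t).+1, rho t.+1 = 0 & (rho t).+1 = r.*2].
    by apply: divmodS; rewrite double_gt0.
  case=> [[eq_q eq_rho _] | [eq_q eq_rho' eq_rho]].
    have -> : q t.+1 + rho t.+1 * a = q t + rho t * a + a.
      by rewrite eq_q eq_rho mulSnr addnA.
    rewrite cdist_modD // /y ?eq_q ?eq_rho; last by rewrite /r; lia.
    by rewrite /= /r; case: (odd _); lia.
  have odd_rho : odd (rho t) by rewrite -[odd _]negbK -oddS eq_rho odd_double.
  have lt_qS := lt_q _ lt_t; rewrite eq_q in lt_qS.
  have -> : (q t.+1 + rho t.+1 * a) %% r = (q t + rho t * a + a.+1) %% r.
    have -> : q t + rho t * a + a.+1 = a.*2 * r + (q t).+1.
      by move: eq_rho; rewrite /r; nia.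
    by rewrite eq_q eq_rho' modnMDl mul0n addn0.
  rewrite cdist_modD //; last by rewrite /r; lia.
  by rewrite /y eq_q eq_rho' odd_rho /= /r; lia.
Qed.

(** Turn [q t] visits the rows [2b, b-1, 2b-1, b-2, ..., 0, b] in this order;
    the row changes are [b+1] and [b] alternately, the last one, from [b] back
    to [2b], being [b] again.  They are accompanied by horizontal moves of
    lengths [a] and [a+1].  With all signs positive the drift of a turn might
    share a factor with [r]; taking the moves [+a, +(a+1), -a, -(a+1)]
    periodically, a turn ends at [0] or [2a+1], and the closing move [a+1]
    gives the drift [a+1] or [3a+2].  Four times the former is [r + 1], four
    times the latter is [3r - 1], so both are prime to [r = 4a+3]. *)
Lemma helical_tour_coloring a b : 0 < b ->
  exists g : 'I_(a.*2.+1).*2.+1 * 'I_(b.*2.+1).*2 -> nat,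
    antipodal_coloring (@toroidal_grid _ _) g
    /\ Defs.span g <= (a + b).+1 * ((a.*2.+1).*2.+1 * b.*2.+1).-1.
Proof.
move=> b_gt0; set r := (a.*2.+1).*2.+1; pose h := b.*2.+1.
pose q t := t %/ h; pose rho t := t %% h.
have lt_rho t : rho t < h by rewrite ltn_pmod.
have tE t : t = q t * h + rho t by apply: divn_eq.
pose y i := if odd i then b.-1 - i./2 else b.*2 - i./2.
pose X i := if odd i then (if odd i./2 then a.+1 else a)
            else (if odd i./2 then a.*2.+1 else 0).
(* [X i] is the displacement after [i] moves of a turn, [T] that of a whole
   turn. *)
pose T := X b.*2 + a.+1.
have y_inj i i' : i < h -> i' < h -> y i = y i' -> i = i'.
  rewrite /y /h => lt_i lt_i'.
  have := odd_double_half i; have := odd_double_half i'.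
  by case: (odd i) (odd i') => [] [] /=; lia.
have T_coprime : coprime r T.
  rewrite /T /X odd_double doubleK; case: (odd b).
    by apply/coprimeP=> //; exists (3, 4); rewrite /r /=; lia.
  by rewrite coprime_sym; apply/coprimeP=> //; exists (4, 1); rewrite /r /=; lia.
apply: (@coloring_of_tour a.*2.+1 h _ (fun t => (q t * T + X (rho t)) %% r)
   (fun t => y (rho t))).
- by rewrite /h; lia.
- move=> t _; rewrite ltn_pmod // /y; split=> //.
  by have := lt_rho t; rewrite /h; case: (odd _); lia.
- move=> t t' lt_t lt_t' eqx /y_inj eq_rho.
  have {}eq_rho : rho t = rho t' by apply: eq_rho.
  rewrite (tE t) (tE t') eq_rho; congr (_ * _ + _).
  have : q t = q t' %[mod r].
    apply/eqP; rewrite -(eqn_modMr_coprime _ _ T_coprime).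
    by move/eqP: eqx; rewrite eq_rho eqn_modDr.
  by rewrite !modn_small // ltn_divLR.
- move=> t lt_t.
  have : [/\ q t.+1 = q t, rho t.+1 = (rho t).+1 & (rho t).+1 < h]
      \/ [/\ q t.+1 = (q t).+1, rho t.+1 = 0 & (rho t).+1 = h].
    exact: divmodS.
  case=> [[-> -> lt_S] | [-> -> eq_S]]; last first.
    (* The turn is complete, and [T] includes this closing move [a.+1]. *)
    have -> : (q t).+1 * T + X 0 = q t * T + X (rho t) + a.+1.
      have -> : rho t = b.*2 by move: eq_S => [].
      by rewrite mulSnr /T /X /=; lia.
    rewrite cdist_modD //; last by rewrite /r; lia.
    by move: eq_S => [->]; rewrite /y odd_double doubleK /= /r; lia.
  rewrite (@cdist_mod _ _ _ (if odd (rho t) then a.+1 else a)) //; first last.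
  - rewrite /X /= uphalf_half; case: (odd (rho t)).
      by rewrite /= ?add1n /=; case: (odd _) => /=; lia.
    by rewrite /= ?add0n; case: (odd _); lia.
  - by rewrite /r; case: (odd _); lia.
  rewrite /y /= uphalf_half; have := odd_double_half (rho t).
  by move: lt_S; rewrite /h /r; case: (odd (rho t)) => /=; lia.
Qed.

(** * The antipodal number *)

Import GRing.Theory.
Local Open Scope ring_scope.

Theorem theorem4p2 (r s : nat) (hr : (3 <= r)%N) (hs : (3 <= s)%N)
    (hrs : (r = 1 %[mod 4] /\ s = 0 %[mod 4])
           \/ (r = 3 %[mod 4] /\ s = 2 %[mod 4])) :
  (antipodal_number (@toroidal_grid r s))%:R =
  1 / 8 * (r%:R ^+ 2 * s%:R + r%:R * s%:R ^+ 2 - r%:R * s%:R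
           - 2 * r%:R - 2 * s%:R + 2) :> rat.
Proof.
have [m [h [k [-> -> def_k h_gt0 [g gP]]]]] : exists m h k, [/\ r = m.*2.+1,
    s = h.*2, m + h = k.*2, 0 < h &
    exists g : 'I_m.*2.+1 * 'I_h.*2 -> nat,
      antipodal_coloring (@toroidal_grid _ _) g
      /\ Defs.span g <= k * (m.*2.+1 * h).-1]%N.
  case: hrs => [[r1 s0] | [r3 s2]].
    exists (r %/ 4).*2, (s %/ 4).*2, (r %/ 4 + s %/ 4)%N.
    by split; [lia | lia | lia | lia | apply: block_tour_coloring; lia].
  exists (r %/ 4).*2.+1, (s %/ 4).*2.+1, (r %/ 4 + s %/ 4).+1.
  by split; [lia | lia | lia | lia | apply: helical_tour_coloring; lia].
rewrite (antipodal_number_eq (n := (k * (m.*2.+1 * h).-1)%N)); last 2 first.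
- by move=> g' /antipodal_span_ge; apply.
- by exists g.
have def_N : ((m.*2.+1 * h).-1%:R : rat) = (2 * m%:R + 1) * h%:R - 1.
  rewrite -subn1 natrB ?muln_gt0 ?h_gt0 // natrM -addn1 natrD -mul2n natrM.
  by ring.
have -> : (m.*2.+1%:R : rat) = 2 * m%:R + 1 by rewrite -addn1 natrD -mul2n natrM.
have -> : (h.*2%:R : rat) = 2 * h%:R by rewrite -mul2n natrM.
have {}def_k : (m%:R : rat) = 2 * k%:R - h%:R.
  by apply/eqP; rewrite eq_sym subr_eq -natrD def_k -mul2n natrM.
by rewrite natrM def_N def_k; field.
Qed.
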